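(* For every integer $n\geq 1$, there exists a globally simple $\mathrm{N}\mathrm{H}_2(n;n)$.
   Context: Let $n,t\ge 1$ be integers with $t$ dividing $2n^2$, let $v=2n^2+t$, and let $J$ be the subgroup of $\mathbb{Z}_v$ of order $t$. A (square, tight, relative) non-zero sum Heffter array $\mathrm{N}\mathrm{H}_t(n;n)$ is an $n\times n$ array $A$ with no empty cells and with entries in $\mathbb{Z}_v$ such that: (i) the multiset $\{\pm x \mid x\in A\}$ contains each element of $\mathbb{Z}_v\setminus J$ exactly once (and no other element); (ii) the sum of the elements in every row and in every column is different from $0$ in $\mathbb{Z}_v$. An ordering $(t_1,\dots,t_k)$ of a finite list of elements of an abelian group is simple if its partial sums $s_i=\sum_{j=1}^i t_j$, $i=1,\dots,k$, are all non-zero and pairwise distinct. A natural ordering of a row (respectively column) is the ordering of its entries read cyclically from left to right (respectively from top to bottom) starting from some chosen entry. The array is globally simple if each row and each column admits at least one natural ordering that is simple. *)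

(* Defs.v *)
From mathcomp Require Import all_boot all_algebra all_fingroup.

Set Implicit Arguments.
Unset Strict Implicit.
Unset Printing Implicit Defensive.

Import GRing.Theory.
Local Open Scope ring_scope.

(* Order of the ambient group; 2 < heffter_mod n t whenever n, t >= 1, so that
   'Z_(heffter_mod n t) is the genuine group of integers modulo 2n^2 + t. *)
Definition heffter_mod (n t : nat) : nat := (2 * n ^ 2 + t)%N.

(* scanl leaves out the empty partial sum: the result is s_1, ..., s_k. *)
Definition partial_sums (G : zmodType) (s : seq G) : seq G := scanl +%R 0 s.

Definition simple_ordering (G : zmodType) (s : seq G) : bool :=
  (0 \notin partial_sums s) && uniq (partial_sums s).

Definition row_seq (T : Type) (m n : nat) (A : 'M[T]_(m, n)) (i : 'I_m) : seq T :=
  [seq A i j | j <- enum 'I_n].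

Definition col_seq (T : Type) (m n : nat) (A : 'M[T]_(m, n)) (j : 'I_n) : seq T :=
  [seq A i j | i <- enum 'I_m].

Definition entries (T : Type) (m n : nat) (A : 'M[T]_(m, n)) : seq T :=
  [seq A i j | i <- enum 'I_m, j <- enum 'I_n].

(* A cyclic group has at most one subgroup J of each order t, and its existence
   forces t >= 1 and t %| 2 * n ^ 2.  The multiset of the +-x is represented by
   a sequence up to permutation, so an entry x = - x would be counted twice. *)
Definition is_NH (n t : nat) (A : 'M['Z_(heffter_mod n t)]_n) : Prop :=
  [/\ exists2 J : {group 'Z_(heffter_mod n t)}, #|J| = t
        & perm_eq (entries A ++ [seq - x | x <- entries A]) (enum (~: J)),
      forall i : 'I_n, \sum_(j < n) A i j != 0
    & forall j : 'I_n, \sum_(i < n) A i j != 0].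

(* The natural orderings of a line are the rotations of its list of entries. *)
Definition globally_simple (G : zmodType) (m n : nat) (A : 'M[G]_(m, n)) : Prop :=
  (forall i : 'I_m, exists k : 'I_n, simple_ordering (rot k (row_seq A i))) /\
  (forall j : 'I_n, exists k : 'I_m, simple_ordering (rot k (col_seq A j))).

(* Main.v *)
Require Import Defs.
From mathcomp Require Import all_boot all_algebra all_fingroup.
From mathcomp Require Import zify.

(** The array is [A i j = (-1)^(i+j) (i n + j + 1)], whose entries are, up to
    sign, [1, ..., n^2].  Each line is, up to a global sign, of the form
    [b, -(b+d), b+2d, -(b+3d), ...], with partial sums
    [b, -d, b+d, -2d, b+2d, ...]: these are distinct non-zero integers spanning
    an interval of length less than [2n^2+2], hence distinct and non-zero
    modulo [2n^2+2]. *)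

Import GRing.Theory.
Local Open Scope ring_scope.

(** The only multiple of [v] smaller than [v] in absolute value is 0. All later claims modulo [v]
    are reduced in this way to claims on small integers. *)
Lemma Zp_intr_eq0 (v : nat) (m : int) :
  (1 < v)%N -> (`|m| < v)%N -> (m%:~R == 0 :> 'Z_v) = (m == 0).
Proof.
have nat_eq0 k : (1 < v)%N -> (k < v)%N -> (k%:R == 0 :> 'Z_v) = (k == 0)%N.
  by move=> v_gt1 k_lt; rewrite -val_eqE /= val_Zp_nat // modn_small.
by case: m => k v_gt1 k_lt; rewrite ?NegzE ?rmorphN ?oppr_eq0 -?pmulrn nat_eq0.
Qed.

Lemma Zp_intr_inj (v : nat) (a b : int) : (1 < v)%N -> (`|a - b| < v)%N ->
  a%:~R = b%:~R :> 'Z_v -> a = b.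
Proof.
move=> v_gt1 ab_lt /eqP; rewrite -subr_eq0 -rmorphB Zp_intr_eq0 // subr_eq0.
by move/eqP.
Qed.

Lemma scanl_mkseq (G : zmodType) (f : nat -> G) (n : nat) (x : G) :
  scanl +%R x (mkseq f n) = mkseq (fun k => x + \sum_(i < k.+1) f i) n.
Proof.
elim: n f x => [|n IHn] f x //.
rewrite /mkseq /= big_ord_recl big_ord0 addr0; congr cons.
rewrite -[1%N]/(1 + 0)%N iotaDl -map_comp -/(mkseq _ n) IHn -map_comp.
by apply: eq_map => k /=; rewrite [in RHS]big_ord_recl addrA.
Qed.

Lemma simple_mkseq (G : zmodType) (f : nat -> G) (n : nat) :
  reflect ((forall k, (k < n)%N -> \sum_(i < k.+1) f i != 0) /\
           {in gtn n &, injective (fun k => \sum_(i < k.+1) f i)})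
    (simple_ordering (mkseq f n)).
Proof.
rewrite /simple_ordering /partial_sums scanl_mkseq.
rewrite (eq_mkseq (g := fun k => \sum_(i < k.+1) f i)); last first.
  by move=> k; rewrite add0r.
apply: (iffP andP) => -[s0 s1]; split.
- move=> k k_lt; apply: contraNneq s0 => sum0.
  by apply/mapP; exists k; rewrite ?mem_iota.
- exact: mkseq_uniqP s1.
- apply/mapP => -[k]; rewrite mem_iota /= => k_lt /esym/eqP.
  exact/negP/s0.
- exact/mkseq_uniqP.
Qed.

(** The total is the last partial sum, so simplicity of the lines also settles the non-zero sum
    condition. *)
Lemma simple_sum_neq0 (G : zmodType) (f : nat -> G) (n : nat) :
  (0 < n)%N -> simple_ordering (mkseq f n) -> \sum_(i < n) f i != 0.
Proof. by case: n => // n _ /simple_mkseq[+ _]; apply. Qed.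

(** Consecutive terms pair up to [-d]; for even [k], setting [b] aside, the remaining terms pair up
    to [d]. *)
Lemma sum_alternating (b d k : nat) :
  \sum_(i < k.+1) (-1) ^+ i * (b + i * d)%N%:Z =
  if odd k then - (k.+1./2 * d)%N%:Z else (b + k./2 * d)%N%:Z.
Proof.
elim: k => [|k IHk]; first by rewrite big_ord1 mul1r.
rewrite big_ord_recr /= {}IHk -signr_odd /=.
have := odd_double_half k; rewrite uphalf_half.
by case: (odd k) => /= <-; nia.
Qed.

(** The exponent [e] carries the global sign of a line. The bound on [b + n * d] controls the spread
    between the extreme partial sums. *)
Lemma simple_alternating (v b d n e : nat) :
  (1 < v)%N -> (0 < b)%N -> (0 < d)%N -> (b + n * d < v)%N ->
  simple_ordering
    (mkseq (fun k => ((-1) ^+ (e + k) * (b + k * d)%N%:Z)%:~R : 'Z_v) n).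
Proof.
move=> v_gt1 b_gt0 d_gt0 v_big; apply/simple_mkseq.
have sumE k : \sum_(i < k.+1) ((-1) ^+ (e + i) * (b + i * d)%N%:Z)%:~R =
  ((-1) ^+ e * if odd k then - (k.+1./2 * d)%N%:Z else (b + k./2 * d)%N%:Z)%:~R
   :> 'Z_v.
  rewrite -sum_alternating big_distrr rmorph_sum; apply: eq_bigr => i _ /=.
  by rewrite exprD mulrA.
split=> [k k_lt|k l].
  rewrite sumE -signr_odd Zp_intr_eq0 //;
    have := odd_double_half k; rewrite /= uphalf_half;
    by case: (odd e); case: (odd k) => /= kE; nia.
rewrite !inE !sumE -signr_odd => k_lt l_lt kl.
have := odd_double_half k; have := odd_double_half l.
move/(Zp_intr_inj _ _ _ v_gt1) in kl; move: kl.
rewrite /= !uphalf_half.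
(* Up to the global sign, sums are at least [b] for even index and at most [-d] for odd index, so
   equality forces equal parity, and then [d > 0] gives [k = l]. *)
case: (odd e); case: (odd k); case: (odd l) => /=.
all: move=> kl lE kE; try (have {}kl := kl ltac:(nia)); try nia.
Qed.

Lemma involution_group (n : nat) (w : 'Z_n) :
  w + w = 0 -> exists J : {group 'Z_n}, J = [set 0; w] :> {set 'Z_n}.
Proof.
move=> ww; suff gJ : group_set [set 0; w] by exists (group gJ).
apply/group_setP; split=> [|x y]; first exact: set21.
by move=> /set2P[->|->] /set2P[->|->]; rewrite !inE;
  rewrite -[(_ * _)%g]/(_ + _) ?ww ?addr0 ?add0r eqxx ?orbT.
Qed.

Lemma row_seq_mkseq (T : Type) (m n : nat) (f : nat -> nat -> T) (i : 'I_m) :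
  row_seq (\matrix_(i < m, j < n) f i j) i = mkseq (f i) n.
Proof.
rewrite /mkseq -val_enum_ord -map_comp.
by apply: eq_map => j /=; rewrite mxE.
Qed.

Lemma col_seq_mkseq (T : Type) (m n : nat) (f : nat -> nat -> T) (j : 'I_n) :
  col_seq (\matrix_(i < m, j < n) f i j) j = mkseq (f^~ j) m.
Proof.
rewrite /mkseq -val_enum_ord -map_comp.
by apply: eq_map => i /=; rewrite mxE.
Qed.

Definition entry (n i j : nat) : int := (-1) ^+ (i + j) * (i * n + j).+1%:Z.

Lemma absz_entry (n i j : nat) : `|entry n i j|%N = (i * n + j).+1.
Proof. by rewrite abszMsign. Qed.

(** Euclidean division of [i * n + j] by [n] recovers [i], then [j]. *)
Lemma entry_inj (n : nat) (i j k l : 'I_n) :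
  `|entry n i j|%N = `|entry n k l|%N -> i = k /\ j = l.
Proof.
rewrite !absz_entry => -[ijkl].
have ik : i = k :> nat.
  have := congr1 (divn^~ n) ijkl; have n_gt0 : (0 < n)%N by case: n i {j k l ijkl} => [[]|].
  by rewrite !divnMDl // !divn_small ?addn0.
by split; apply: val_inj => //=; move: ijkl; rewrite ik => /addnI.
Qed.

Lemma absz_entry_bound (n : nat) (i j : 'I_n) : (0 < `|entry n i j| <= n ^ 2)%N.
Proof.
rewrite absz_entry /=; have := ltn_ord i; have := ltn_ord j; nia.
Qed.

Definition alternating_array (n : nat) : 'M['Z_(heffter_mod n 2)]_n :=
  \matrix_(i < n, j < n) (entry n i j)%:~R.

(** Here [b = i * n + 1] and [d = 1], so [b + n * d] is at most [n ^ 2 + 1]. *)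
Lemma row_simple (n : nat) (i : 'I_n) :
  simple_ordering (mkseq (fun j => (entry n i j)%:~R : 'Z_(heffter_mod n 2)) n).
Proof.
rewrite (eq_mkseq (g := fun j => ((-1) ^+ (i + j) * ((i * n).+1 + j * 1)%N%:Z)%:~R)).
  by apply: simple_alternating => //; have := ltn_ord i; rewrite /heffter_mod; nia.
by move=> j; rewrite muln1.
Qed.

(** Here [b = j + 1] and [d = n], so [b + n * d] is at most [n ^ 2 + n]. *)
Lemma col_simple (n : nat) (j : 'I_n) :
  simple_ordering (mkseq (fun i => (entry n i j)%:~R : 'Z_(heffter_mod n 2)) n).
Proof.
rewrite (eq_mkseq (g := fun i => ((-1) ^+ (j + i) * (j.+1 + i * n)%N%:Z)%:~R)).
  by apply: simple_alternating => //; have := ltn_ord j; rewrite /heffter_mod; nia.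
by move=> i; rewrite /entry [(j + i)%N]addnC addSn [(j + _)%N]addnC.
Qed.

Lemma entries_array (n : nat) : entries (alternating_array n) =
  [seq (entry n i j)%:~R | i : 'I_n <- enum 'I_n, j : 'I_n <- enum 'I_n].
Proof. by apply: eq_allpairs => i j; rewrite mxE. Qed.

(** By counting: the [2 * n ^ 2] signed entries are distinct and avoid [J], whose complement has
    that same size. *)
Lemma array_support (n : nat) : exists2 J : {group 'Z_(heffter_mod n 2)}, #|J| = 2 &
  perm_eq (entries (alternating_array n) ++ [seq - x | x <- entries (alternating_array n)])
    (enum (~: J)).
Proof.
(* [w] is the class of [v / 2], the element of order 2. *)
set v := heffter_mod n 2; pose w : 'Z_v := (n ^ 2).+1%:R.
have v_gt1 : (1 < v)%N by rewrite /v /heffter_mod addn2.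
have vE : v = (2 * (n ^ 2).+1)%N by rewrite /v /heffter_mod; lia.
have ww : w + w = 0 by rewrite -natrD addnn -mul2n -vE pchar_Zp.
have w_neq0 : 0 != w.
  by rewrite eq_sym /w pmulrn Zp_intr_eq0 // vE; lia.
have [J JE] := involution_group _ _ ww; have J2 : #|J| = 2 by rewrite JE cards2 w_neq0.
exists J => //; rewrite !entries_array.
set s := flatten _.
have s_uniq : uniq s.
  apply: allpairs_uniq; rewrite ?enum_uniq // => -[i j] [k l] _ _ /=.
  move/(Zp_intr_inj _ _ _ v_gt1) => eq_ij.
  have [|-> -> //] := entry_inj n i j k l; rewrite eq_ij //.
  have := absz_entry_bound _ i j; have := absz_entry_bound _ k l; rewrite vE; lia.
(* Opposite entries have equal absolute values, hence share a cell, and a non-zero integer is not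
   its own opposite. *)
have s_opp_disj : ~~ has (mem s) [seq - x | x <- s].
  apply/hasPn => _ /mapP[_ /allpairsP[[i j] /= [_ _ ->]] ->].
  apply/allpairsP => -[[k l] /= [_ _]]; rewrite -rmorphN.
  have := absz_entry_bound _ i j; have := absz_entry_bound _ k l => kl_bd ij_bd.
  move/(Zp_intr_inj _ _ _ v_gt1) => eq_ij; have {}eq_ij := eq_ij ltac:(rewrite vE; lia).
  have [|ik jl] := entry_inj n i j k l; first by rewrite -eq_ij abszN.
  by move: eq_ij ij_bd; rewrite ik jl; lia.
have t_uniq : uniq (s ++ [seq - x | x <- s]).
  by rewrite cat_uniq s_uniq s_opp_disj map_inj_uniq //; exact: oppr_inj.
have s_notJ x : x \in s -> x \notin J.
  case/allpairsP => -[i j] /= [_ _ ->]; rewrite JE !inE.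
  have ij_bd := absz_entry_bound _ i j.
  (* An entry lies between [- n ^ 2] and [n ^ 2], so its distance to [n ^ 2 + 1] is positive and at
     most [2 * n ^ 2 + 1 = v - 1]. *)
  rewrite /w [_.+1%:R]pmulrn -[X in _ || X]subr_eq0 -rmorphB !Zp_intr_eq0 // ?vE; lia.
have t_sub : {subset s ++ [seq - x | x <- s] <= enum (~: J)}.
  move=> x; rewrite mem_enum inE mem_cat => /orP[/s_notJ //|/mapP[y /s_notJ yJ ->]].
  by rewrite -[- y]/(y^-1)%g groupV.
have size_le : (size (enum (~: J)) <= size (s ++ [seq - x | x <- s]))%N.
  rewrite -cardE cardsCs setCK J2 card_ord Zp_cast //.
  rewrite size_cat size_map size_allpairs -!cardE card_ord vE; lia.
by apply: uniq_perm; rewrite ?enum_uniq //; case: (uniq_min_size t_uniq t_sub size_le).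
Qed.

Theorem proposition3p2 (n : nat) (hn : (1 <= n)%N) :
  exists A : 'M['Z_(heffter_mod n 2)]_n, is_NH A /\ globally_simple A.
Proof.
exists (alternating_array n); split; last first.
  (* [Ordinal hn] is index 0: every line is simple when read from its first entry. *)
  split=> i; exists (Ordinal hn); rewrite rot0.
    by rewrite (row_seq_mkseq _ _ _ (fun i j => (entry n i j)%:~R)) row_simple.
  by rewrite (col_seq_mkseq _ _ _ (fun i j => (entry n i j)%:~R)) col_simple.
split=> [|i|j]; first exact: array_support.
  under eq_bigr do rewrite mxE.
  exact: simple_sum_neq0 hn (row_simple n i).
under eq_bigr do rewrite mxE.
exact: simple_sum_neq0 hn (col_simple n j).
Qed.
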